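(* Let $n\ge1$, let $\sigma\in\mathcal W$, $\sigma_j=\Delta_j\sigma$, and let $\rho(t)$ be a polynomial in $t$ of degree at most $n-1$ with coefficients in $\bar U(n)$ satisfying $\Delta_j\rho(t)=\frac{e(t)}{1+\tilde h_jt}\sigma_j$ for $j=1,\dots,n$, so that the polynomial $$c(t)=\sum_{i=1}^n\frac{e(t)}{1+\tilde h_it}\,\bar\partial_ix^i-\rho(t)$$ has central coefficients in $\mathrm{Diff}_{\mathbf h,\sigma}(n)$. Let $\vec\lambda=(\lambda_1,\dots,\lambda_n)$ be a sequence of complex numbers such that $\lambda_i-\lambda_j\notin\mathbb Z$ for all $i\ne j$. Then $c(t)$ acts on the lowest weight representation $\mathrm{Ind}_{\mathfrak D_n}^{\mathrm{Diff}_{\mathbf h,\sigma}(n)}M_{\vec\lambda}$ by multiplication by the scalar $$-\rho(t)[-\varepsilon],\qquad \varepsilon=\varepsilon_1+\dots+\varepsilon_n,$$ evaluated at $\tilde h_i=\lambda_i$, $i=1,\dots,n$ (that is, by $-\rho(t)$ evaluated at $\tilde h_i=\lambda_i-1$ for all $i$).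
   Context: The ground field is $\mathbb K=\mathbb C$. $U(n)=\mathbb K[\tilde h_1,\dots,\tilde h_n]$ is the commutative polynomial ring, $\tilde h_{ij}=\tilde h_i-\tilde h_j$, and $\bar U(n)$ is the localization of $U(n)$ with respect to the multiplicative set generated by all $\tilde h_{ij}+a$, $a\in\mathbb Z$, $i\ne j$. For $p\in\bar U(n)$, $p[\pm\varepsilon_j]$ denotes the image of $p$ under the automorphism $\tilde h_i\mapsto\tilde h_i\pm\delta_{ij}$ ($i=1,\dots,n$), and $p[-\varepsilon]$ the image under $\tilde h_i\mapsto\tilde h_i-1$ for all $i$; these act coefficientwise on polynomials in the auxiliary central variable $t$. $\Delta_j f:=f-f[-\varepsilon_j]$. $e(t)=\prod_{i=1}^n(1+\tilde h_it)$. $\chi_j:=\prod_{k\ne j}\tilde h_{jk}$; $\mathcal W_j$ is the $\mathbb K$-vector space of elements $\pi(\tilde h_j)/\chi_j$ with $\pi$ a univariate polynomial over $\mathbb K$; $\mathcal W:=\sum_{j=1}^n\mathcal W_j$. For $\sigma\in\mathcal W$ and $\sigma_i:=\Delta_i\sigma$, the ring $\mathrm{Diff}_{\mathbf h,\sigma}(n)$ is the ring generated over $\bar U(n)$ by $x^i,\bar\partial_i$, $i=1,\dots,n$, with the defining relations $\tilde h_i x^j=x^j(\tilde h_i+\delta_{ij})$, $\tilde h_i\bar\partial_j=\bar\partial_j(\tilde h_i-\delta_{ij})$ for all $i,j$ (hence $p\,x^j=x^j\,p[\varepsilon_j]$, $p\,\bar\partial_j=\bar\partial_j\,p[-\varepsilon_j]$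 for $p\in\bar U(n)$), together with $$x^ix^j=\frac{\tilde h_{ij}+1}{\tilde h_{ij}}x^jx^i,\qquad \bar\partial_i\bar\partial_j=\frac{\tilde h_{ij}-1}{\tilde h_{ij}}\bar\partial_j\bar\partial_i\qquad(i<j),$$ $$x^i\bar\partial_j=\bar\partial_jx^i\ \ (i<j),\qquad x^i\bar\partial_j=\frac{\tilde h_{ij}(\tilde h_{ij}-2)}{(\tilde h_{ij}-1)^2}\bar\partial_jx^i\ \ (i>j),$$ $$x^i\bar\partial_i=\sum_{j=1}^n\frac{1}{1-\tilde h_{ij}}\bar\partial_jx^j-\sigma_i,\qquad i=1,\dots,n.$$ $\mathfrak D_n$ is the subring of $\mathrm{Diff}_{\mathbf h,\sigma}(n)$ generated by $\bar U(n)$ and $\bar\partial_1,\dots,\bar\partial_n$. $M_{\vec\lambda}$ is the one-dimensional $\mathbb K$-vector space with basis vector $|\;\rangle$ and the $\mathfrak D_n$-module structure $\tilde h_i|\;\rangle=\lambda_i|\;\rangle$, $\bar\partial_i|\;\rangle=0$, $i=1,\dots,n$. The lowest weight representation of lowest weight $\vec\lambda$ is the induced module $\mathrm{Ind}_{\mathfrak D_n}^{\mathrm{Diff}_{\mathbf h,\sigma}(n)}M_{\vec\lambda}=\mathrm{Diff}_{\mathbf h,\sigma}(n)\otimes_{\mathfrak D_n}M_{\vec\lambda}$. *)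

(* Defs.v *)
From HB Require Import structures.
From mathcomp Require Import all_boot all_order all_algebra.
From mathcomp Require Import generic_quotient fraction complex mpoly.
From mathcomp Require Import boolp reals.

Set Implicit Arguments.
Unset Strict Implicit.
Unset Printing Implicit Defensive.

Import GRing.Theory.
Local Open Scope ring_scope.
Local Open Scope quotient_scope.

(* Rings given by generators and relations.  [presented rel] is the ring      *)
(* generated over the ring B by symbols indexed by G, with the defining       *)
(* relations s = t for [rel s t]: formal expressions modulo the least ring    *)
(* congruence that contains [rel] and makes [TCoef] a ring morphism.  It is   *)
(* only a pzRingType because 1 != 0 may fail for an arbitrary [rel].          *)
Section Presented.
Variables (B : pzRingType) (G : Type).

Inductive rterm : Type :=
| TCoef of B
| TGen of G
| TOpp of rterm
| TAdd of rterm & rterm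
| TMul of rterm & rterm.

HB.instance Definition _ := gen_eqMixin rterm.
HB.instance Definition _ := gen_choiceMixin rterm.

Variable rel : rterm -> rterm -> Prop.

Inductive rcongr : rterm -> rterm -> Prop :=
| rc_rel s t : rel s t -> rcongr s t
| rc_refl t : rcongr t t
| rc_sym s t : rcongr s t -> rcongr t s
| rc_trans s t u : rcongr s t -> rcongr t u -> rcongr s u
| rc_opp s s' : rcongr s s' -> rcongr (TOpp s) (TOpp s')
| rc_add s s' t t' : rcongr s s' -> rcongr t t' ->
    rcongr (TAdd s t) (TAdd s' t')
| rc_mul s s' t t' : rcongr s s' -> rcongr t t' ->
    rcongr (TMul s t) (TMul s' t')
| rc_addA s t u : rcongr (TAdd s (TAdd t u)) (TAdd (TAdd s t) u)
| rc_addC s t : rcongr (TAdd s t) (TAdd t s)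
| rc_add0 t : rcongr (TAdd (TCoef 0) t) t
| rc_addN t : rcongr (TAdd (TOpp t) t) (TCoef 0)
| rc_mulA s t u : rcongr (TMul s (TMul t u)) (TMul (TMul s t) u)
| rc_1mul t : rcongr (TMul (TCoef 1) t) t
| rc_mul1 t : rcongr (TMul t (TCoef 1)) t
| rc_mulDl s t u : rcongr (TMul (TAdd s t) u) (TAdd (TMul s u) (TMul t u))
| rc_mulDr s t u : rcongr (TMul s (TAdd t u)) (TAdd (TMul s t) (TMul s u))
| rc_coefD a b : rcongr (TCoef (a + b)) (TAdd (TCoef a) (TCoef b))
| rc_coefM a b : rcongr (TCoef (a * b)) (TMul (TCoef a) (TCoef b)).

Definition rcongrb (s t : rterm) : bool := `[< rcongr s t >].

Lemma rcongrb_refl : reflexive rcongrb.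
Proof. by move=> t; apply/asboolP; exact: rc_refl. Qed.

Lemma rcongrb_sym : ssrbool.symmetric rcongrb.
Proof. by move=> s t; apply/asboolP/asboolP; exact: rc_sym. Qed.

Lemma rcongrb_trans : transitive rcongrb.
Proof.
by move=> t s u /asboolP st /asboolP tu; apply/asboolP; exact: rc_trans st tu.
Qed.

Canonical rcongr_equiv := EquivRel rcongrb rcongrb_refl rcongrb_sym rcongrb_trans.

Definition presented := {eq_quot rcongr_equiv}.

HB.instance Definition _ := EqQuotient.on presented.
HB.instance Definition _ := Choice.on presented.

Definition pclass (t : rterm) : presented := \pi_presented t.
Definition pcoef (b : B) : presented := pclass (TCoef b).
Definition pgen (g : G) : presented := pclass (TGen g).

Lemma pclassP s t : pclass s = pclass t <-> rcongr s t.
Proof. by split=> [/eqquotP/asboolP|st]; last by apply/eqquotP/asboolP. Qed.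

Lemma pclassW (P : presented -> Prop) :
  (forall t, P (pclass t)) -> forall a, P a.
Proof. by move=> Pt; elim/quotW. Qed.

Lemma repr_pclass t : rcongr (repr (pclass t)) t.
Proof. by apply/pclassP; rewrite /pclass reprK. Qed.

Definition popp (a : presented) := pclass (TOpp (repr a)).
Definition padd (a b : presented) := pclass (TAdd (repr a) (repr b)).
Definition pmul (a b : presented) := pclass (TMul (repr a) (repr b)).

Lemma poppE t : popp (pclass t) = pclass (TOpp t).
Proof. by apply/pclassP/rc_opp/repr_pclass. Qed.

Lemma paddE s t : padd (pclass s) (pclass t) = pclass (TAdd s t).
Proof. by apply/pclassP/rc_add; exact: repr_pclass. Qed.

Lemma pmulE s t : pmul (pclass s) (pclass t) = pclass (TMul s t).
Proof. by apply/pclassP/rc_mul; exact: repr_pclass. Qed.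

Fact paddA : associative padd.
Proof.
elim/pclassW=> s; elim/pclassW=> t; elim/pclassW=> u.
by rewrite !paddE; apply/pclassP/rc_addA.
Qed.
Fact paddC : commutative padd.
Proof.
by elim/pclassW=> s; elim/pclassW=> t; rewrite !paddE; apply/pclassP/rc_addC.
Qed.
Fact padd0 : left_id (pcoef 0) padd.
Proof. by elim/pclassW=> t; rewrite paddE; apply/pclassP/rc_add0. Qed.
Fact paddN : left_inverse (pcoef 0) popp padd.
Proof. by elim/pclassW=> t; rewrite poppE paddE; apply/pclassP/rc_addN. Qed.
Fact pmulA : associative pmul.
Proof.
elim/pclassW=> s; elim/pclassW=> t; elim/pclassW=> u.
by rewrite !pmulE; apply/pclassP/rc_mulA.
Qed.
Fact p1mul : left_id (pcoef 1) pmul.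
Proof. by elim/pclassW=> t; rewrite pmulE; apply/pclassP/rc_1mul. Qed.
Fact pmul1 : right_id (pcoef 1) pmul.
Proof. by elim/pclassW=> t; rewrite pmulE; apply/pclassP/rc_mul1. Qed.
Fact pmulDl : left_distributive pmul padd.
Proof.
elim/pclassW=> s; elim/pclassW=> t; elim/pclassW=> u.
by rewrite !(pmulE, paddE); apply/pclassP/rc_mulDl.
Qed.
Fact pmulDr : right_distributive pmul padd.
Proof.
elim/pclassW=> s; elim/pclassW=> t; elim/pclassW=> u.
by rewrite !(pmulE, paddE); apply/pclassP/rc_mulDr.
Qed.

HB.instance Definition _ := GRing.isPzRing.Build presented
  paddA paddC padd0 paddN pmulA p1mul pmul1 pmulDl pmulDr.

Lemma pclassN t : pclass (TOpp t) = - pclass t.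
Proof. by rewrite -poppE. Qed.

Lemma pclassD s t : pclass (TAdd s t) = pclass s + pclass t.
Proof. by rewrite -paddE. Qed.

Lemma pclassM s t : pclass (TMul s t) = pclass s * pclass t.
Proof. by rewrite -pmulE. Qed.

Fact pcoef_is_zmod : zmod_morphism pcoef.
Proof.
have pcoefD a b : pcoef (a + b) = pcoef a + pcoef b.
  by rewrite -pclassD; apply/pclassP/rc_coefD.
by move=> a b; apply: (addIr (pcoef b)); rewrite -pcoefD !subrK.
Qed.
Fact pcoef_is_monoid : monoid_morphism pcoef.
Proof. by split=> // a b; rewrite -pclassM; apply/pclassP/rc_coefM. Qed.

HB.instance Definition _ := GRing.isZmodMorphism.Build B presented pcoef
  pcoef_is_zmod.
HB.instance Definition _ := GRing.isMonoidMorphism.Build B presented pcoef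
  pcoef_is_monoid.

End Presented.

Arguments TGen {B G}.
Arguments TCoef {B G}.

Declare Scope rterm_scope.
Delimit Scope rterm_scope with T.
Bind Scope rterm_scope with rterm.
Notation "s + t" := (TAdd s t) : rterm_scope.
Notation "s * t" := (TMul s t) : rterm_scope.
Notation "- t" := (TOpp t) : rterm_scope.
Notation "s - t" := (TAdd s (TOpp t)) : rterm_scope.
Notation "\sum_ ( i < n ) F" :=
  (\big[@TAdd _ _/TCoef 0]_(i < n) F%T) : rterm_scope.

(* The subring of A generated by a subset P. *)
Section Subring.
Variables (A : pzRingType) (P : A -> Prop).

Inductive in_subring : A -> Prop :=
| is_gen a : P a -> in_subring a
| is_one : in_subring 1
| is_sub a b : in_subring a -> in_subring b -> in_subring (a - b)
| is_mul a b : in_subring a -> in_subring b -> in_subring (a * b).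

Definition subring_pred : {pred A} := fun a => `[< in_subring a >].

Fact subring_predP : GRing.subring_closed subring_pred.
Proof.
split=> [|a b /asboolP aP /asboolP bP|a b /asboolP aP /asboolP bP].
- by apply/asboolP; exact: is_one.
- by apply/asboolP; exact: is_sub.
- by apply/asboolP; exact: is_mul.
Qed.

HB.instance Definition _ :=
  GRing.isSubringClosed.Build A subring_pred subring_predP.

Record subring := Subring { subring_val : A; _ : subring_val \in subring_pred }.

HB.instance Definition _ := [isSub for subring_val].
HB.instance Definition _ := [Choice of subring by <:].
HB.instance Definition _ :=
  GRing.SubChoice_isSubPzRing.Build A subring_pred subring subring_predP.

Definition subring_incl : {rmorphism subring -> A} := \val.

Definition subring_gen (a : A) (aP : P a) : subring :=
  Subring (asboolT (is_gen aP)).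

End Subring.

(* The induced module A (x)_S M along a ring morphism f : S -> A: formal sums *)
(* of symbols a (x) m modulo biadditivity and (a f(s)) (x) m = a (x) (s m).   *)
Section Induced.
Variables (S A : pzRingType) (f : {rmorphism S -> A}) (M : lmodType S).

Inductive tterm : Type :=
| TPure of A & M
| TZero
| TNeg of tterm
| TPlus of tterm & tterm.

HB.instance Definition _ := gen_eqMixin tterm.
HB.instance Definition _ := gen_choiceMixin tterm.

Inductive tcongr : tterm -> tterm -> Prop :=
| tc_refl t : tcongr t t
| tc_sym s t : tcongr s t -> tcongr t s
| tc_trans s t u : tcongr s t -> tcongr t u -> tcongr s u
| tc_neg s s' : tcongr s s' -> tcongr (TNeg s) (TNeg s')
| tc_plus s s' t t' : tcongr s s' -> tcongr t t' ->
    tcongr (TPlus s t) (TPlus s' t')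
| tc_plusA s t u : tcongr (TPlus s (TPlus t u)) (TPlus (TPlus s t) u)
| tc_plusC s t : tcongr (TPlus s t) (TPlus t s)
| tc_plus0 t : tcongr (TPlus TZero t) t
| tc_plusN t : tcongr (TPlus (TNeg t) t) TZero
| tc_pureDl a b m : tcongr (TPure (a + b) m) (TPlus (TPure a m) (TPure b m))
| tc_pureDr a m m' : tcongr (TPure a (m + m')) (TPlus (TPure a m) (TPure a m'))
| tc_balanced a s m : tcongr (TPure (a * f s) m) (TPure a (s *: m)).

Definition tcongrb (s t : tterm) : bool := `[< tcongr s t >].

Lemma tcongrb_refl : reflexive tcongrb.
Proof. by move=> t; apply/asboolP; exact: tc_refl. Qed.

Lemma tcongrb_sym : ssrbool.symmetric tcongrb.
Proof. by move=> s t; apply/asboolP/asboolP; exact: tc_sym. Qed.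

Lemma tcongrb_trans : transitive tcongrb.
Proof.
by move=> t s u /asboolP st /asboolP tu; apply/asboolP; exact: tc_trans st tu.
Qed.

Canonical tcongr_equiv := EquivRel tcongrb tcongrb_refl tcongrb_sym tcongrb_trans.

Definition induced := {eq_quot tcongr_equiv}.

HB.instance Definition _ := EqQuotient.on induced.
HB.instance Definition _ := Choice.on induced.

Definition tclass (t : tterm) : induced := \pi_induced t.

Lemma tclassP s t : tclass s = tclass t <-> tcongr s t.
Proof. by split=> [/eqquotP/asboolP|st]; last by apply/eqquotP/asboolP. Qed.

Lemma tclassW (P : induced -> Prop) :
  (forall t, P (tclass t)) -> forall a, P a.
Proof. by move=> Pt; elim/quotW. Qed.

Lemma repr_tclass t : tcongr (repr (tclass t)) t.
Proof. by apply/tclassP; rewrite /tclass reprK. Qed.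

Definition ineg (v : induced) := tclass (TNeg (repr v)).
Definition iplus (v w : induced) := tclass (TPlus (repr v) (repr w)).

Lemma inegE t : ineg (tclass t) = tclass (TNeg t).
Proof. by apply/tclassP/tc_neg/repr_tclass. Qed.

Lemma iplusE s t : iplus (tclass s) (tclass t) = tclass (TPlus s t).
Proof. by apply/tclassP/tc_plus; exact: repr_tclass. Qed.

Fact iplusA : associative iplus.
Proof.
elim/tclassW=> s; elim/tclassW=> t; elim/tclassW=> u.
by rewrite !iplusE; apply/tclassP/tc_plusA.
Qed.
Fact iplusC : commutative iplus.
Proof.
by elim/tclassW=> s; elim/tclassW=> t; rewrite !iplusE; apply/tclassP/tc_plusC.
Qed.
Fact iplus0 : left_id (tclass TZero) iplus.
Proof. by elim/tclassW=> t; rewrite iplusE; apply/tclassP/tc_plus0. Qed.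
Fact iplusN : left_inverse (tclass TZero) ineg iplus.
Proof. by elim/tclassW=> t; rewrite inegE iplusE; apply/tclassP/tc_plusN. Qed.

HB.instance Definition _ := GRing.isZmodule.Build induced
  iplusA iplusC iplus0 iplusN.

Lemma tclass0 : tclass TZero = 0. Proof. by []. Qed.

Lemma tclassN t : tclass (TNeg t) = - tclass t.
Proof. by rewrite -inegE. Qed.

Lemma tclassD s t : tclass (TPlus s t) = tclass s + tclass t.
Proof. by rewrite -iplusE. Qed.

Fixpoint tact (a : A) (t : tterm) : tterm :=
  match t with
  | TPure b m => TPure (a * b) m
  | TZero => TZero
  | TNeg s => TNeg (tact a s)
  | TPlus s u => TPlus (tact a s) (tact a u)
  end.

Lemma tact_congr a s t : tcongr s t -> tcongr (tact a s) (tact a t).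
Proof.
elim=> {s t} /=.
- by move=> t; exact: tc_refl.
- by move=> s t _; exact: tc_sym.
- by move=> s t u _ st _; exact: tc_trans st.
- by move=> s t _; exact: tc_neg.
- by move=> s s' t t' _ ss' _; exact: tc_plus.
- by move=> *; exact: tc_plusA.
- by move=> *; exact: tc_plusC.
- by move=> *; exact: tc_plus0.
- by move=> *; exact: tc_plusN.
- by move=> *; rewrite mulrDr; exact: tc_pureDl.
- by move=> *; exact: tc_pureDr.
- by move=> *; rewrite mulrA; exact: tc_balanced.
Qed.

Definition iscale (a : A) (v : induced) : induced := tclass (tact a (repr v)).

Lemma iscaleE a t : iscale a (tclass t) = tclass (tact a t).
Proof. by apply/tclassP/tact_congr/repr_tclass. Qed.

Fact iscaleA a b v : iscale a (iscale b v) = iscale (a * b) v.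
Proof.
elim/tclassW: v => t; rewrite !iscaleE; congr tclass.
by elim: t => //= [c m|s ->//|s -> u ->//]; rewrite mulrA.
Qed.
Fact iscale1 : left_id 1 iscale.
Proof.
elim/tclassW=> t; rewrite iscaleE; congr tclass.
by elim: t => //= [c m|s ->//|s -> u ->//]; rewrite mul1r.
Qed.
Fact iscaleDr : right_distributive iscale +%R.
Proof.
by move=> a; elim/tclassW=> s; elim/tclassW=> t; rewrite -tclassD !iscaleE tclassD.
Qed.
Fact iscaleDl v : {morph iscale^~ v : a b / a + b >-> a + b}.
Proof.
move=> a b; elim/tclassW: v => t; rewrite !iscaleE.
elim: t => [c m||s IHs|s IHs u IHu] /=.
- by rewrite mulrDl -tclassD; apply/tclassP/tc_pureDl.
- by rewrite tclass0 addr0.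
- by rewrite !tclassN IHs opprD.
- by rewrite !tclassD IHs IHu addrACA.
Qed.

HB.instance Definition _ := GRing.Zmodule_isLmodule.Build A induced
  iscaleA iscale1 iscaleDr iscaleDl.

Definition ipure (a : A) (m : M) : induced := tclass (TPure a m).

End Induced.

(* The variables of U(n) are 'X_i, and Ubar(n) is realised inside the         *)
(* fraction field of U(n).                                                    *)
Section Ubar.
Variables (K : fieldType) (n : nat).
Local Notation U := {mpoly K[n]}.
Local Notation "p %:F" := (tofrac (p : U)).

Definition hfactor (i j : 'I_n) (a : int) : U := 'X_i - 'X_j + a%:~R.

Inductive denom : U -> Prop :=
| denom1 : denom 1
| denomM i j a s : i != j -> denom s -> denom (hfactor i j a * s).

Definition Ubar_pred : {pred {fraction U}} :=
  fun u => `[< exists p s, denom s /\ u = p%:F / s%:F >].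

Lemma denom_mul s t : denom s -> denom t -> denom (s * t).
Proof.
move=> + tP; elim=> [|i j a s' ij _ IH]; first by rewrite mul1r.
by rewrite -mulrA; exact: denomM.
Qed.

Lemma hfactor_neq0 i j a : i != j -> hfactor i j a != 0.
Proof.
move=> ij; apply/eqP => /(congr1 (mcoeff U_(i))) /eqP.
have -> : hfactor i j a = 'X_i - 'X_j + (a%:~R)%:MP by rewrite rmorph_int.
rewrite mcoeff0 mcoeffD mcoeffB !mcoeffX mcoeffC eqxx mnm1_eq0 mulr0 addr0.
rewrite (_ : (U_(j) == U_(i))%MM = false) ?subr0 ?oner_eq0 //.
apply/negP => /eqP/mnmP/(_ i); rewrite !mnm1E eqxx eq_sym.
by rewrite (negPf ij).
Qed.

Lemma denom_neq0 s : denom s -> s != 0.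
Proof.
elim=> [|i j a s' ij _ s0]; first exact: oner_neq0.
by rewrite mulf_neq0 // hfactor_neq0.
Qed.

Lemma denomF_neq0 s : denom s -> s%:F != 0.
Proof. by move=> /denom_neq0; rewrite tofrac_eq0. Qed.

Fact Ubar_predP : GRing.subring_closed Ubar_pred.
Proof.
split=> [|u v /asboolP[p [s [sP ->]]] /asboolP[q [t [tP ->]]]
         |u v /asboolP[p [s [sP ->]]] /asboolP[q [t [tP ->]]]].
- apply/asboolP; exists 1, 1; split; first exact: denom1.
  by rewrite tofrac1 divr1.
- apply/asboolP; exists (p * t - q * s), (s * t); split; first exact: denom_mul.
  rewrite -mulNr addf_div ?denomF_neq0 //.
  by rewrite tofracB !tofracM mulNr.
- apply/asboolP; exists (p * q), (s * t); split; first exact: denom_mul.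
  by rewrite mulf_div !tofracM.
Qed.

HB.instance Definition _ :=
  GRing.isSubringClosed.Build {fraction U} Ubar_pred Ubar_predP.

Record Ubar := MkUbar { Ubar_val : {fraction U}; _ : Ubar_val \in Ubar_pred }.

HB.instance Definition _ := [isSub for Ubar_val].
HB.instance Definition _ := [Choice of Ubar by <:].
HB.instance Definition _ := [SubChoice_isSubComNzRing of Ubar by <:].

Definition Ubar_unit : {pred Ubar} :=
  fun u => (\val u != 0) && ((\val u)^-1 \in Ubar_pred).
Definition Ubar_inv (u : Ubar) : Ubar :=
  if u \in Ubar_unit then insubd u (\val u)^-1 else u.

Lemma val_Ubar_inv u : u \in Ubar_unit -> \val (Ubar_inv u) = (\val u)^-1.
Proof.
by rewrite /Ubar_inv => uU; rewrite uU; case/andP: uU => _ uV; rewrite insubdK.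
Qed.

Fact Ubar_mulVr : {in Ubar_unit, left_inverse 1 Ubar_inv *%R}.
Proof.
move=> u uU; apply: val_inj; rewrite rmorphM /= val_Ubar_inv // mulVf //.
by case/andP: uU.
Qed.
Fact Ubar_unitPl (u v : Ubar) : v * u = 1 -> Ubar_unit u.
Proof.
move=> /(congr1 val); rewrite rmorphM rmorph1 /= => vu.
have u0 : \val u != 0.
  by apply/eqP => u0; move/eqP: vu; rewrite u0 mulr0 eq_sym oner_eq0.
apply/andP; split=> //; rewrite (_ : _^-1 = \val v) ?(valP v) //.
by apply: (mulIf u0); rewrite mulVf.
Qed.
Fact Ubar_invr_out : {in [predC Ubar_unit], Ubar_inv =1 id}.
Proof. by move=> u; rewrite inE /Ubar_inv => /negPf ->. Qed.

HB.instance Definition _ := GRing.ComNzRing_hasMulInverse.Build Ubar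
  Ubar_mulVr Ubar_unitPl Ubar_invr_out.

Lemma val_UbarV (u : Ubar) : u \is a GRing.unit -> \val u^-1 = (\val u)^-1.
Proof. exact: val_Ubar_inv. Qed.

Fact ofpoly_subproof (p : U) : p%:F \in Ubar_pred.
Proof.
by apply/asboolP; exists p, 1; split; [exact: denom1|rewrite tofrac1 divr1].
Qed.

Definition ofpoly (p : U) : Ubar := MkUbar (ofpoly_subproof p).

Fact ofpoly_is_zmod : zmod_morphism ofpoly.
Proof. by move=> p q; apply: val_inj; rewrite rmorphB /= tofracB. Qed.
Fact ofpoly_is_monoid : monoid_morphism ofpoly.
Proof.
by split=> [|p q]; apply: val_inj; rewrite ?rmorph1 ?rmorphM /= ?tofrac1 ?tofracM.
Qed.

HB.instance Definition _ := GRing.isZmodMorphism.Build U Ubar ofpoly ofpoly_is_zmod.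
HB.instance Definition _ :=
  GRing.isMonoidMorphism.Build U Ubar ofpoly ofpoly_is_monoid.

Lemma ofpoly_unit s : denom s -> ofpoly s \is a GRing.unit.
Proof.
move=> sP; rewrite unfold_in; apply/andP; split; first exact: denomF_neq0.
by apply/asboolP; exists 1, s; rewrite tofrac1 div1r.
Qed.

Lemma Ubar_fracP (u : Ubar) :
  exists ps : U * U, denom ps.2 /\ u = ofpoly ps.1 / ofpoly ps.2.
Proof.
have /asboolP[p [s [sP us]]] := valP u; exists (p, s); split=> //=.
apply: (mulIr (ofpoly_unit sP)); rewrite divrK ?ofpoly_unit //.
by apply: val_inj; rewrite rmorphM /= us divfK // denomF_neq0.
Qed.

Definition unum (u : Ubar) : U := (projT1 (cid (Ubar_fracP u))).1.
Definition uden (u : Ubar) : U := (projT1 (cid (Ubar_fracP u))).2.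

Lemma uden_denom u : denom (uden u).
Proof. by rewrite /uden; case: cid => ps []. Qed.

Lemma unum_uden u : u = ofpoly (unum u) / ofpoly (uden u).
Proof. by rewrite /unum /uden; case: cid => ps []. Qed.

Definition uconst (a : K) : Ubar := ofpoly a%:MP.
Definition h (i : 'I_n) : Ubar := ofpoly 'X_i.
Definition hh (i j : 'I_n) : Ubar := h i - h j.

(* [shift v u] is the image of u under h_i |-> h_i + v_i.  It is computed on  *)
(* a fraction p/s with s in the multiplicative set; by [shift_frac] below the *)
(* result does not depend on the fraction.                                    *)
Definition mshift (v : 'I_n -> int) (p : U) : U :=
  p \mPo [tuple 'X_i + (v i)%:~R | i < n].
Definition shift (v : 'I_n -> int) (u : Ubar) : Ubar :=
  ofpoly (mshift v (unum u)) / ofpoly (mshift v (uden u)).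

Definition epsN (j : 'I_n) : 'I_n -> int := fun i => - (i == j)%:Z.
Definition epsN_all : 'I_n -> int := fun=> - 1.

Definition Delta (j : 'I_n) (u : Ubar) : Ubar := u - shift (epsN j) u.

(* Evaluation at h_i = lam_i, meaningful when no lam_i - lam_j with i != j is *)
(* an integer; see [ueval_frac].                                              *)
Definition ueval (lam : 'I_n -> K) (u : Ubar) : K :=
  (unum u).@[lam] / (uden u).@[lam].

Lemma mshift_denom v s : denom s -> denom (mshift v s).
Proof.
elim=> [|i j a s' ij _ IH]; rewrite /mshift ?rmorph1 ?rmorphM /=.
  exact: denom1.
rewrite (_ : hfactor i j a \mPo _ = hfactor i j (a + v i - v j)).
  exact: denomM.
rewrite /hfactor rmorphD rmorphB rmorph_int /= !comp_mpolyXU -!tnth_nth.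
rewrite !tnth_mktuple !rmorphB !rmorphD /= opprD addrACA [RHS]addrC.
by rewrite -(addrA a%:~R) [LHS]addrC [LHS]addrA [LHS]addrAC.
Qed.

Lemma val_frac p s : denom s -> \val (ofpoly p / ofpoly s) = p%:F / s%:F.
Proof.
move=> sP; have sV : \val (ofpoly s)^-1 = (s%:F)^-1.
  exact: (val_UbarV (ofpoly_unit sP)).
by rewrite -sV; exact: (rmorphM (\val : Ubar -> {fraction U})).
Qed.

Lemma ofpoly_frac_eq p s q t : denom s -> denom t ->
  (ofpoly p / ofpoly s == ofpoly q / ofpoly t) = (p * t == q * s).
Proof.
move=> sP tP; rewrite -(inj_eq val_inj) !val_frac // eqr_div ?denomF_neq0 //.
by rewrite -!tofracM tofrac_eq.
Qed.

Lemma shift_frac v p s : denom s ->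
  shift v (ofpoly p / ofpoly s) = ofpoly (mshift v p) / ofpoly (mshift v s).
Proof.
move=> sP; set u := _ / _; have uP := uden_denom u.
apply/eqP; rewrite ofpoly_frac_eq; try exact: mshift_denom.
rewrite /mshift -!rmorphM; apply/eqP; congr (_ \mPo _).
by apply/eqP; rewrite -ofpoly_frac_eq // -unum_uden.
Qed.

Lemma denom_eval (lam : 'I_n -> K) s :
  (forall i j, i != j -> forall a : int, lam i - lam j != a%:~R) ->
  denom s -> s.@[lam] != 0.
Proof.
move=> lamP; elim=> [|i j a s' ij _ IH]; first by rewrite meval1 oner_eq0.
rewrite mevalM mulf_neq0 // /hfactor rmorphD rmorphB rmorph_int /= !mevalXU.
by rewrite -[a%:~R]opprK subr_eq0 -rmorphN lamP.
Qed.

Lemma ueval_frac (lam : 'I_n -> K) p s :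
  (forall i j, i != j -> forall a : int, lam i - lam j != a%:~R) ->
  denom s -> ueval lam (ofpoly p / ofpoly s) = p.@[lam] / s.@[lam].
Proof.
move=> lamP sP; set u := _ / _; have uP := uden_denom u.
apply/eqP; rewrite eqr_div ?denom_eval // -!mevalM; apply/eqP.
by congr (_.@[_]); apply/eqP; rewrite -ofpoly_frac_eq // -unum_uden.
Qed.

Definition chi (j : 'I_n) : Ubar := \prod_(k < n | k != j) hh j k.

Definition in_Wj (j : 'I_n) (w : Ubar) : Prop :=
  exists pi : {poly K}, w = (map_poly uconst pi).[h j] / chi j.

Definition in_W (w : Ubar) : Prop :=
  exists ws : 'I_n -> Ubar,
    (forall j, in_Wj j (ws j)) /\ w = \sum_(j < n) ws j.

Definition e_poly : {poly Ubar} := \prod_(i < n) (1 + h i *: 'X).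

Definition ehat (j : 'I_n) : {poly Ubar} :=
  \prod_(i < n | i != j) (1 + h i *: 'X).

Lemma e_polyE j : e_poly = (1 + h j *: 'X) * ehat j.
Proof. by rewrite /e_poly (bigD1 j). Qed.

End Ubar.

Section Diff.
Variables (K : fieldType) (n : nat) (sigma : Ubar K n).
Local Notation Ub := (Ubar K n).
Local Notation term := (rterm Ub ('I_n + 'I_n)).
Local Notation C u := (TCoef u%R : term).
Local Notation X i := (TGen (inl i) : term).
Local Notation D i := (TGen (inr i) : term).
Local Notation h := (@h K n).
Local Notation hh := (@hh K n).

(* [dr_Kx] and [dr_Kd] say that Diff is an algebra over the ground field.     *)
Inductive diff_rel : term -> term -> Prop :=
| dr_Kx (a : K) j : diff_rel (C (uconst n a) * X j) (X j * C (uconst n a))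
| dr_Kd (a : K) j : diff_rel (C (uconst n a) * D j) (D j * C (uconst n a))
| dr_hx (i j : 'I_n) : diff_rel (C (h i) * X j) (X j * C (h i + (i == j)%:R))
| dr_hd (i j : 'I_n) : diff_rel (C (h i) * D j) (D j * C (h i - (i == j)%:R))
| dr_xx (i j : 'I_n) : (i < j)%N ->
    diff_rel (X i * X j) (C ((hh i j + 1) / hh i j) * (X j * X i))
| dr_dd (i j : 'I_n) : (i < j)%N ->
    diff_rel (D i * D j) (C ((hh i j - 1) / hh i j) * (D j * D i))
| dr_xd_lt (i j : 'I_n) : (i < j)%N -> diff_rel (X i * D j) (D j * X i)
| dr_xd_gt (i j : 'I_n) : (j < i)%N ->
    diff_rel (X i * D j)
      (C (hh i j * (hh i j - 2) / (hh i j - 1) ^+ 2) * (D j * X i))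
| dr_xd_eq i :
    diff_rel (X i * D i)
      (\sum_(j < n) (C (1 / (1 - hh i j)) * (D j * X j)) - C (Delta i sigma)).

Definition Diff := presented diff_rel.
HB.instance Definition _ := GRing.PzRing.on Diff.

Definition dcoef : {rmorphism Ub -> Diff} := @pcoef _ _ diff_rel.
Definition dx (i : 'I_n) : Diff := pgen diff_rel (inl i).
Definition dd (i : 'I_n) : Diff := pgen diff_rel (inr i).
Definition dscal (a : K) : Diff := dcoef (uconst n a).

Inductive Dn_gen : Diff -> Prop :=
| Dn_coef u : Dn_gen (dcoef u)
| Dn_dd i : Dn_gen (dd i).

Definition Dn := subring Dn_gen.
HB.instance Definition _ := GRing.PzRing.on Dn.

Definition ncoef (u : Ub) : Dn := subring_gen (Dn_coef u).
Definition nd (i : 'I_n) : Dn := subring_gen (Dn_dd i).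
Definition nscal (a : K) : Dn := ncoef (uconst n a).

(* The D_n-module M is M_lambda with basis vector vac; K acts through         *)
(* K -> Ubar(n) -> D_n.                                                       *)
Definition is_lowest_weight_module (lam : 'I_n -> K) (M : lmodType Dn)
    (vac : M) : Prop :=
  [/\ forall m : M, exists! a : K, m = nscal a *: vac,
      forall i, ncoef (h i) *: vac = nscal (lam i) *: vac
    & forall i, nd i *: vac = 0].

Definition Ind (M : lmodType Dn) : lmodType Diff := induced (subring_incl Dn_gen) M.

(* The coefficient of t^k in c(t).  The polynomial c(t) is handled through    *)
(* its coefficients, as {poly Diff} would need a proof of 1 != 0 in Diff.     *)
Definition c_coef (rho : {poly Ub}) (k : nat) : Diff :=
  \sum_(i < n) dcoef (ehat K i)`_k * (dd i * dx i) - dcoef rho`_k.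

End Diff.

(* Main.v *)
(* Write y_i = d_i x^i.  Using the formula for x^j d_j once, both x^j c(t) and  *)
(* c(t) d_j take the form B x^j and d_j B with the same B, which is c(t)       *)
(* rewritten; so c(t) is central and it suffices to find its value on the     *)
(* vacuum.  There x^i d_i = 0, so sum_j y_j / (1 - h_ij) acts as sigma_i.  A   *)
(* polynomial of degree < n is determined by its values at the points         *)
(* t_i = 1 / (1 - h_i).  With e_i(t) = e(t) / (1 + h_i t), at t_i one has      *)
(* e_j = e_i / (1 - h_ij), and also rho - rho[-eps] = sigma_i e_i, because     *)
(* for k != i the difference rho - rho[-eps_k] is divisible by 1 + h_i t.      *)
(* Interpolating, sum_j e_j y_j acts on the vacuum as rho - rho[-eps].        *)

From HB Require Import structures.
Require Import Defs.
From mathcomp Require Import all_boot all_order all_algebra.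
From mathcomp Require Import fraction complex mpoly.
From mathcomp Require Import boolp reals ring.
Import GRing.Theory.
Local Open Scope ring_scope.

Set Implicit Arguments.
Unset Strict Implicit.
Unset Printing Implicit Defensive.

(** Centrality: [c_coef_reorder] rewrites c(t) with x^j d_j in place of y_j = d_j x^j. By [dx_dddx]
    and [dddx_dd] the other y_i pass x^j and d_j with one and the same factor, and [ehat_recombine]
    makes the coefficients match. A central element is then determined by its value on the
    generating vector w ([lowest_weight_scalar]).

    Value on w: the vectors y_j w are never computed one by one. The equations x^i d_i w = 0 say
    that sum_j y_j w / (1 - h_ij) = sigma_i w. By interpolation, one and the same combination over i
    turns the 1 / (1 - h_ij) into a coefficient of e_j ([ehat_coef_interp]) and the sigma_i into
    that of rho - rho[-eps] ([shift_all_root], [interpolation_coef]). Applied to the equations it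
    gives the sum in c(t) ([c_coef_vacuum]). *)

(** * Shifts and units in the localized ring *)

Section Localization.
Variables (K : fieldType) (n : nat).
Local Notation Ub := (Ubar K n).
Local Notation h := (@h K n).
Local Notation hh := (@hh K n).
Implicit Types (v w : 'I_n -> int) (u : Ub) (i j k : 'I_n).

Lemma shift_ofpoly v p : shift v (ofpoly p) = ofpoly (mshift v p) :> Ub.
Proof.
have := shift_frac v p (denom1 K n).
by rewrite /mshift !rmorph1 !divr1.
Qed.

Fact shift_is_zmod v : zmod_morphism (@shift K n v).
Proof.
move=> a b.
have [[sP tP] [sP' tP']] := ((uden_denom a, uden_denom b),
  (mshift_denom v (uden_denom a), mshift_denom v (uden_denom b))).
have -> : a - b =
  ofpoly (unum a * uden b - unum b * uden a) / ofpoly (uden a * uden b).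
  rewrite [X in X - _]unum_uden [X in _ - X]unum_uden.
  apply: (mulIr (ofpoly_unit (denom_mul sP tP))).
  rewrite divrK ?ofpoly_unit //; last exact: denom_mul.
  rewrite !(rmorphB, rmorphM) /= mulrBl mulrA divrK ?ofpoly_unit //.
  by rewrite [ofpoly (uden a) * _]mulrC mulrA divrK ?ofpoly_unit.
rewrite shift_frac //; last exact: denom_mul.
rewrite /shift; apply: (mulIr (ofpoly_unit (denom_mul sP' tP'))).
rewrite /mshift in sP' tP' *.
rewrite (rmorphM _ (uden a)) /= divrK ?ofpoly_unit //; last exact: denom_mul.
rewrite !(rmorphB, rmorphM) /= mulrBl mulrA divrK ?ofpoly_unit //.
by rewrite [ofpoly (uden a \mPo _) * _]mulrC mulrA divrK ?ofpoly_unit.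
Qed.

Fact shift_is_monoid v : monoid_morphism (@shift K n v).
Proof.
split=> [|a b]; first by rewrite -(rmorph1 (@ofpoly K n)) shift_ofpoly /mshift !rmorph1.
have [[sP tP] [sP' tP']] := ((uden_denom a, uden_denom b),
  (mshift_denom v (uden_denom a), mshift_denom v (uden_denom b))).
have -> : a * b = ofpoly (unum a * unum b) / ofpoly (uden a * uden b).
  rewrite {1}[a]unum_uden {1}[b]unum_uden mulrACA !rmorphM /=.
  by rewrite invrM ?ofpoly_unit // [_^-1 * _ in RHS]mulrC.
rewrite shift_frac //; last exact: denom_mul.
rewrite /shift /mshift in sP' tP' *.
by rewrite !rmorphM /= mulrACA invrM ?ofpoly_unit // [_^-1 * _ in RHS]mulrC.
Qed.

HB.instance Definition _ v :=
  GRing.isZmodMorphism.Build Ub Ub (@shift K n v) (shift_is_zmod v).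
HB.instance Definition _ v :=
  GRing.isMonoidMorphism.Build Ub Ub (@shift K n v) (shift_is_monoid v).

Lemma shiftB v : {morph @shift K n v : a b / a - b}.
Proof. exact: rmorphB. Qed.

Lemma shift_uconst v (a : K) : shift v (uconst n a) = uconst n a.
Proof. by rewrite /uconst shift_ofpoly /mshift comp_mpolyC. Qed.

Lemma shift_h v i : shift v (h i) = h i + (v i)%:~R.
Proof.
rewrite /Defs.h shift_ofpoly /mshift comp_mpolyXU -tnth_nth tnth_mktuple.
by rewrite rmorphD rmorph_int.
Qed.

Lemma shift_hh v i j : shift v (hh i j) = hh i j + (v i - v j)%:~R.
Proof. by rewrite /Defs.hh shiftB !shift_h rmorphB /= opprD addrACA. Qed.

(** Denominators are units, so closure under inverses of units reaches every fraction without
    mention of numerators. *)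
Lemma Ubar_ind (P : Ub -> Prop) :
  (forall a : K, P (uconst n a)) -> (forall i, P (h i)) ->
  (forall a b, P a -> P b -> P (a + b)) ->
  (forall a b, P a -> P b -> P (a * b)) ->
  (forall a, a \is a GRing.unit -> P a -> P a^-1) ->
  forall u, P u.
Proof.
move=> Pc Ph PD PM PV u.
have Pp p : P (ofpoly p).
  elim/mpolyind: p => [|a m p _ _ IH].
    by have := Pc 0; rewrite /uconst mpolyC0.
  rewrite rmorphD; apply: (PD) => //.
  rewrite -mul_mpolyC rmorphM; apply: (PM); first exact: Pc.
  rewrite mpolyXE_id rmorph_prod /=; elim/big_ind: _ => //.
    by have := Pc 1; rewrite /uconst rmorph1.
  move=> i _; rewrite rmorphXn; elim: (m i) => [|e IHe].
    by have := Pc 1; rewrite expr0 /uconst rmorph1.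
  by rewrite exprS; apply: PM => //; exact: Ph.
rewrite [u]unum_uden; apply: PM => //; apply: PV => //.
exact: ofpoly_unit (uden_denom u).
Qed.

Lemma Ubar_rmorph_eq (f g : {rmorphism Ub -> Ub}) :
  (forall a : K, f (uconst n a) = g (uconst n a)) ->
  (forall i, f (h i) = g (h i)) -> f =1 g.
Proof.
move=> fgc fgh; elim/Ubar_ind => // [a b IHa IHb|a b IHa IHb|a aU IH].
- by rewrite !rmorphD IHa IHb.
- by rewrite !rmorphM IHa IHb.
- by rewrite !rmorphV ?rmorph_unit // IH.
Qed.

Lemma shift_comp v w u : shift v (shift w u) = shift (fun i => v i + w i) u.
Proof.
apply: (Ubar_rmorph_eq (f := shift v \o shift w)) => [a|i] /=.
  by rewrite !shift_uconst.
by rewrite !shift_h rmorphD /= rmorph_int shift_h -addrA -intrD.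
Qed.

Lemma hhD_unit i j (a : int) : i != j -> hh i j + a%:~R \is a GRing.unit.
Proof.
move=> ij; have := ofpoly_unit (denomM a ij (denom1 K n)).
by rewrite mulr1 /hfactor rmorphD rmorphB rmorph_int.
Qed.

Lemma hh_unit i j : i != j -> hh i j \is a GRing.unit.
Proof. by move=> ij; rewrite -[hh i j]addr0 -[0]/(0%:~R) hhD_unit. Qed.

Lemma hhB1_unit i j : i != j -> hh i j - 1 \is a GRing.unit.
Proof. by move=> ij; rewrite -[- 1]/((- 1)%:~R) hhD_unit. Qed.

Lemma hhD1_unit i j : i != j -> hh i j + 1 \is a GRing.unit.
Proof. by move=> ij; rewrite -[1]/(1%:~R) hhD_unit. Qed.

Lemma hhD2_unit i j : i != j -> hh i j + 2 \is a GRing.unit.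
Proof. by move=> ij; rewrite -[2]/(2%:~R) hhD_unit. Qed.

Lemma hhN i j : hh i j = - hh j i.
Proof. by rewrite /Defs.hh opprB. Qed.

Lemma shift_hhl i j : i != j -> shift (epsN i) (hh i j) = hh i j - 1.
Proof.
by move=> ij; rewrite shift_hh /epsN eqxx eq_sym (negPf ij) oppr0 subr0.
Qed.

Lemma shift_hhr i j : i != j -> shift (epsN j) (hh i j) = hh i j + 1.
Proof.
by move=> ij; rewrite shift_hh /epsN eqxx (negPf ij) oppr0 sub0r opprK.
Qed.

End Localization.

(** * Rational identities in x = h_ij, with s a unit shift of x *)

Section FractionIdentities.
Variable A : comUnitRingType.
Implicit Types (a b c d x y : A).

Lemma frac_eq a b c d :
  b \is a GRing.unit -> d \is a GRing.unit -> a * d = c * b -> a / b = c / d.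
Proof.
move=> bU dU e; apply: (mulIr dU); rewrite divrK // mulrAC e.
by rewrite mulrK.
Qed.

Lemma mul_frac_opp x :
  x - 1 \is a GRing.unit -> - x + 2 \is a GRing.unit ->
  x * (x - 2) / (x - 1) ^+ 2 * ((- x + 1) / (- x + 2)) = x / (x - 1).
Proof.
move=> xU1 xU2; rewrite mulrACA -invrM ?unitrX //.
by apply: frac_eq; rewrite ?unitrM ?unitrX ?xU2 ?xU1 //; ring.
Qed.

Lemma frac_opp_succ x : - x + 1 \is a GRing.unit -> x - 1 \is a GRing.unit ->
  - x / (- x + 1) = x / (x - 1).
Proof. by move=> xU xU1; apply: frac_eq => //; ring. Qed.

Variable s : {rmorphism A -> A}.

Lemma rmorph_frac a b : b \is a GRing.unit -> s (a / b) = s a / s b.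
Proof. by move=> bU; rewrite rmorphM rmorphV. Qed.

Lemma rmorph_down_succ_frac x : s x = x - 1 -> x + 2 \is a GRing.unit ->
  s ((x + 1) / (x + 2)) = x / (x + 1).
Proof.
move=> sx xU; rewrite rmorph_frac // !rmorphD rmorph1 sx.
by congr (_ / _); ring.
Qed.

Lemma rmorph_up_frac_pred x : s x = x + 1 -> x - 1 \is a GRing.unit ->
  s (x / (x - 1)) = (x + 1) / x.
Proof. by move=> sx xU; rewrite rmorph_frac // rmorphB rmorph1 sx addrK. Qed.

Lemma rmorph_up_pred_frac x : s x = x + 1 -> x \is a GRing.unit ->
  s ((x - 1) / x) = x / (x + 1).
Proof. by move=> sx xU; rewrite rmorph_frac // rmorphB rmorph1 sx addrK. Qed.

Lemma rmorph_down_sqr_frac x : s x = x - 1 -> x \is a GRing.unit ->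
  s ((x + 1) * (x - 1) / x ^+ 2) = x * (x - 2) / (x - 1) ^+ 2.
Proof.
move=> sx xU; rewrite rmorph_frac ?unitrX // rmorphM rmorphB rmorphD rmorphXn rmorph1 sx.
by congr (_ / _); ring.
Qed.

Lemma rmorph_down_mul_frac x : s x = x - 1 ->
  x \is a GRing.unit -> x - 1 \is a GRing.unit ->
  s (x / (x - 1) * ((- x + 1) * (- x - 1) / (- x) ^+ 2)) = x / (x - 1).
Proof.
move=> sx xU xU1.
have -> : x / (x - 1) * ((- x + 1) * (- x - 1) / (- x) ^+ 2) = (x + 1) / x.
  rewrite mulrACA -invrM ?unitrX ?unitrN //.
  by apply: frac_eq; rewrite ?unitrM ?unitrX ?unitrN ?xU //; ring.
by rewrite rmorph_frac // rmorphD rmorph1 sx subrK.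
Qed.

End FractionIdentities.

(** * Commutation relations between x^i, d_j and the coefficients *)

Section Relations.
Variables (K : fieldType) (n : nat) (sigma : Ubar K n).
Local Notation Ub := (Ubar K n).
Local Notation h := (@h K n).
Local Notation hh := (@hh K n).
Local Notation C := (dcoef sigma).
Local Notation X := (dx sigma).
Local Notation D := (dd sigma).
Implicit Types (u : Ub) (i j k : 'I_n).

Lemma pclass_rel s t : diff_rel sigma s t ->
  pclass (diff_rel sigma) s = pclass (diff_rel sigma) t.
Proof. by move=> st; apply/pclassP/rc_rel. Qed.

(** The presentation imposes commutation only with constants and the h_i. It passes to an inverse by
    multiplying T c(a) = d(a) T by d(a^-1) on the left and c(a^-1) on the right. *)
Lemma twist_commute (A : pzRingType) (c d : {rmorphism Ub -> A}) (T : A) :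
  (forall a : K, T * c (uconst n a) = d (uconst n a) * T) ->
  (forall i, T * c (h i) = d (h i) * T) ->
  forall u, T * c u = d u * T.
Proof.
move=> Tc Th; elim/Ubar_ind => // [a b IHa IHb|a b IHa IHb|a aU IH].
- by rewrite !rmorphD mulrDr IHa IHb mulrDl.
- by rewrite !rmorphM mulrA IHa -mulrA IHb mulrA.
- have VM (f : {rmorphism Ub -> A}) : f a * f a^-1 = 1 /\ f a^-1 * f a = 1.
    by rewrite -!rmorphM divrr // mulVr // rmorph1.
  rewrite -[LHS]mul1r -(VM d).2 -mulrA [d a * _]mulrA -IH -!mulrA (VM c).1.
  by rewrite mulr1.
Qed.

Lemma dx_dcoef j u : X j * C u = C (shift (epsN j) u) * X j.
Proof.
apply: (twist_commute (d := C \o shift (epsN j))) => [a|i] /=.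
  by have := pclass_rel (dr_Kx sigma a j); rewrite !pclassM shift_uconst => ->.
have := pclass_rel (dr_hx sigma i j); rewrite !pclassM.
rewrite -[pclass _ (TCoef (Defs.h K i + _))]/(C _) -[pclass _ (TGen _)]/(X j).
(* The relation h_i x^j = x^j (h_i + delta_ij) is solved for x^j h_i. *)
rewrite -[pclass _ (TCoef _)]/(C _) [C (_ + _)]rmorphD /= mulrDr => /(canLR (addrK _)) <-.
rewrite shift_h [C (_ + _)]rmorphD mulrDl /epsN; congr (_ + _).
by rewrite mulrNz -pmulrn rmorphN !rmorph_nat mulNr mulr_natr mulr_natl.
Qed.

Lemma dcoef_dd j u : C u * D j = D j * C (shift (epsN j) u).
Proof.
symmetry; apply: (twist_commute (c := C \o shift (epsN j))) => [a|i] /=.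
  by have := pclass_rel (dr_Kd sigma a j); rewrite !pclassM shift_uconst => ->.
have := pclass_rel (dr_hd sigma i j); rewrite !pclassM => ->.
congr (_ * C _); rewrite shift_h /epsN; congr (_ + _).
by rewrite mulrNz -pmulrn.
Qed.

Lemma dx_dd_eq i :
  X i * D i = \sum_j C (1 / (1 - hh i j)) * (D j * X j) - C (Delta i sigma).
Proof.
have := pclass_rel (dr_xd_eq sigma i); rewrite pclassD pclassN pclassM => ->.
congr (_ - _); rewrite (big_morph (@pclass _ _ _) (@pclassD _ _ _) (erefl _)).
by apply: eq_bigr => j _; rewrite !pclassM.
Qed.

Lemma dx_dx_lt i j : (i < j)%N ->
  X i * X j = C ((hh i j + 1) / hh i j) * (X j * X i).
Proof. by move=> ij; have := pclass_rel (dr_xx sigma ij); rewrite !pclassM. Qed.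

Lemma dd_dd_lt i j : (i < j)%N ->
  D i * D j = C ((hh i j - 1) / hh i j) * (D j * D i).
Proof. by move=> ij; have := pclass_rel (dr_dd sigma ij); rewrite !pclassM. Qed.

Lemma dx_dd_lt i j : (i < j)%N -> X i * D j = D j * X i.
Proof. by move=> ij; have := pclass_rel (dr_xd_lt sigma ij); rewrite !pclassM. Qed.

Lemma dx_dd_gt i j : (j < i)%N ->
  X i * D j = C (hh i j * (hh i j - 2) / (hh i j - 1) ^+ 2) * (D j * X i).
Proof. by move=> ij; have := pclass_rel (dr_xd_gt sigma ij); rewrite !pclassM. Qed.

(** The quadratic relations are imposed for one order of the indices; this solves them for the
    other. *)
Lemma dcoef_frac_swap a b (v w : Diff sigma) :
  a \is a GRing.unit -> b \is a GRing.unit ->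
  v = C (a / b) * w -> w = C (b / a) * v.
Proof.
by move=> aU bU ->; rewrite mulrA -rmorphM mulrA divrK // divrr // rmorph1 mul1r.
Qed.

(* The factor picked up by d_i x^i when it passes x^j or d_j. *)
Definition exchange_factor j i : Ub := hh j i / (hh j i - 1).

(** For i < j both exchanges contribute a fraction, for j < i only that of x^j with x^i. Once the
    fraction to the right of d_i is moved left, with its shift, the total is the same in both
    orders. *)
Lemma dx_dddx j i : i != j ->
  X j * (D i * X i) = C (exchange_factor j i) * (D i * X i) * X j.
Proof.
rewrite /exchange_factor => ij; have ji : j != i by rewrite eq_sym.
have [lt_ij|lt_ji|/val_inj/eqP] := ltngtP i j; last by rewrite (negPf ij).
- rewrite mulrA dx_dd_gt // -!mulrA.
  rewrite (dcoef_frac_swap _ _ (dx_dx_lt lt_ij)) ?hh_unit ?hhD1_unit //.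
  rewrite -(rmorph_down_succ_frac (s := shift (epsN i)) (shift_hhl K ij) (hhD2_unit K ij)) /=.
  rewrite (mulrA (D i)) -dcoef_dd !mulrA -rmorphM /=; do 3!congr (_ * _).
  congr (C _); rewrite [hh i j]hhN.
  by rewrite mul_frac_opp -?hhN ?hhB1_unit ?hhD1_unit ?hhD2_unit.
- rewrite mulrA dx_dd_lt // -!mulrA dx_dx_lt // !mulrA; congr (_ * _ * _).
  rewrite dcoef_dd; congr (_ * C _); symmetry.
  exact: (rmorph_up_frac_pred (s := shift (epsN i)) (shift_hhr K ji) (hhB1_unit K ji)).
Qed.

(** The factor agrees with that of [dx_dddx], which is why one rewriting of c(t) serves both x^j and
    d_j. *)
Lemma dddx_dd j i : i != j ->
  D i * X i * D j = D j * (C (exchange_factor j i) * (D i * X i)).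
Proof.
rewrite /exchange_factor => ij; have ji : j != i by rewrite eq_sym.
have [lt_ij|lt_ji|/val_inj/eqP] := ltngtP i j; last by rewrite (negPf ij).
- rewrite -mulrA dx_dd_lt // mulrA dd_dd_lt // !mulrA dcoef_dd.
  do 2!congr (_ * _); congr (_ * C _).
  rewrite (rmorph_up_pred_frac (s := shift (epsN j)) (shift_hhr K ij) (hh_unit K ij)).
  by rewrite [hh i j]hhN frac_opp_succ -?hhN ?hhD1_unit ?hhB1_unit.
- rewrite -mulrA dx_dd_gt //.
  rewrite -(rmorph_down_sqr_frac (s := shift (epsN i)) (shift_hhl K ij) (hh_unit K ij)) /=.
  rewrite !mulrA -dcoef_dd -(mulrA (C _)).
  rewrite (dcoef_frac_swap _ _ (dd_dd_lt lt_ji)) ?hh_unit ?hhB1_unit //.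
  rewrite !mulrA -rmorphM dcoef_dd; do 2!congr (_ * _); congr (_ * C _).
  rewrite [_ * (hh j i / _)]mulrC [hh i j]hhN.
  exact: (rmorph_down_mul_frac (s := shift (epsN j)) (shift_hhl K ji)
    (hh_unit K ji) (hhB1_unit K ji)).
Qed.

End Relations.

(** * Lagrange interpolation over a field *)

(** This is [ehat] with arbitrary values in place of the h_m, so that its images in a field can be
    named. *)
Definition prod_but (A : comNzRingType) n (a : 'I_n -> A) (i : 'I_n) : {poly A} :=
  \prod_(m < n | m != i) (1 + a m *: 'X).

Lemma size_prod_but (A : comNzRingType) n (a : 'I_n -> A) (i : 'I_n) :
  (size (prod_but a i) <= n)%N.
Proof.
rewrite /prod_but; apply: leq_trans (size_prod_leq _ _) _.
have sz m : (size ((1 + a m *: 'X)%R : {poly A}) <= 2)%N.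
  rewrite (leq_trans (size_polyD _ _)) // geq_max size_poly1 /=.
  by rewrite (leq_trans (size_scale_leq _ _)) // size_polyX.
have cardE : #|[pred m : 'I_n | m != i]| = n.-1.
  by have := cardC1 i; rewrite card_ord.
have n_gt0 : (0 < n)%N by exact: leq_ltn_trans (ltn_ord i).
have : (\sum_(m < n | m != i) size (1 + a m *: 'X)%R <= \sum_(m < n | m != i) 2)%N.
  by apply: leq_sum => m _; exact: sz.
rewrite sum_nat_const cardE leq_subLR => /leq_ltn_trans; apply.
by rewrite muln2 -addnn -[X in (_ < _ + X)%N](prednK n_gt0) addnS.
Qed.

Section Interpolation.
Variables (F : fieldType) (n : nat).
Implicit Types (a b : 'I_n -> F) (i j : 'I_n).

(* Lagrange interpolation at the points 1 / (1 - a i): the polynomial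
   [prod_but (a - 1) i] vanishes at all of them but the i-th. *)
Lemma interpolation a b (Q : {poly F}) :
  injective a -> (forall i, a i != 1) -> (size Q <= n)%N ->
  (forall i, Q.[(1 - a i)^-1] = b i * (prod_but a i).[(1 - a i)^-1]) ->
  Q = \sum_(i < n) (\prod_(m < n | m != i) ((a i - a m - 1) / (a i - a m)) * b i)
        *: prod_but (fun m => a m - 1) i.
Proof.
move=> a_inj a1 sizeQ Qt; set S := \sum_i _.
have a1' i : 1 - a i != 0 by rewrite subr_eq0 eq_sym a1.
pose t i := (1 - a i)^-1.
have t_inj : injective t.
  by move=> i j /invr_inj/addrI/oppr_inj/a_inj.
apply/eqP; rewrite -subr_eq0; apply/eqP.
apply: (@roots_geq_poly_eq0 _ _ [seq t i | i : 'I_n]).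
- apply/allP => _ /mapP[i _ ->]; rewrite rootE hornerD hornerN subr_eq0 {}Qt.
  rewrite horner_sum (bigD1 i) //= [X in _ == _ + X]big1 ?addr0 => [|m mi].
    rewrite hornerZ mulrAC mulrC; apply/eqP; congr (_ * _).
    (* At t = t_i one has (a_i - a_m - 1) (1 + (a_m - 1) t) = (a_i - a_m) (1 + a_m t). *)
    rewrite /prod_but !horner_prod -big_split /=; apply: eq_bigr => m mi.
    have am : a i - a m != 0.
      by rewrite subr_eq0 (inj_eq a_inj) eq_sym.
    rewrite !hornerE /t.
    by field; rewrite am a1'.
  (* For m != i the m-th summand has the factor 1 + (a_i - 1) t, which vanishes at t_i. *)
  rewrite hornerZ /prod_but horner_prod [X in _ * X](bigD1 i) 1?eq_sym //=.
  have z : 1 + (a i - 1) / (1 - a i) = 0 by field; rewrite a1'.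
  by rewrite !hornerE /t z /= mulr0 mul0r.
- by rewrite map_inj_uniq ?enum_uniq.
- rewrite size_map size_enum_ord (leq_trans (size_polyD _ _)) //.
  rewrite size_polyN geq_max sizeQ (leq_trans (size_sum _ _ _)) //.
  apply/bigmax_leqP => i _; rewrite (leq_trans (size_scale_leq _ _)) //.
  exact: size_prod_but.
Qed.

End Interpolation.

(** * The polynomials e_i, and congruences that stand for values at the nodes *)

Section UbarPolynomials.
Variables (K : fieldType) (n : nat).
Local Notation Ub := (Ubar K n).
Local Notation h := (@h K n).
Local Notation hh := (@hh K n).
Implicit Types (u : Ub) (i j : 'I_n).

Lemma map_poly_linear_factor (A B : nzRingType) (f : {rmorphism A -> B}) c :
  map_poly f (1 + c *: 'X) = 1 + f c *: 'X.
Proof. by rewrite rmorphD rmorph1 /= map_polyZ /= map_polyX. Qed.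

Lemma map_shift_ehat v i : map_poly (shift v) (ehat K i) =
  \prod_(m < n | m != i) (1 + (h m + (v m)%:~R) *: 'X).
Proof.
rewrite /ehat rmorph_prod /=; apply: eq_bigr => m _.
by rewrite map_poly_linear_factor /= shift_h.
Qed.

Lemma map_shift_ehat_id j : map_poly (shift (epsN j)) (ehat K j) = ehat K j.
Proof.
rewrite map_shift_ehat; apply: eq_bigr => m mj.
by rewrite /epsN (negPf mj) oppr0 addr0.
Qed.

Lemma linear_factor_id (A : comUnitRingType) (a b : A) :
  a - b - 1 \is a GRing.unit ->
  ((a - b) / (a - b - 1)) *: (1 + (a - 1) *: 'X) +
    (1 / (1 - (a - b))) *: (1 + b *: 'X) = 1 + a *: 'X :> {poly A}.
Proof.
rewrite -[1 - (a - b)]opprB => xU; rewrite invrN mulrN mul1r.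
set w := (a - b - 1)^-1; have xw : (a - b - 1) * w = 1 by rewrite divrr.
rewrite !scalerDr !scalerA addrACA -!scalerDl.
have -> : (a - b) * w - w = (a - b - 1) * w by ring.
have -> : (a - b) * w * (a - 1) + - w * b = (a - b - 1) * w * a by ring.
by rewrite xw scale1r mul1r.
Qed.

(** The factors other than those of i and j are common and free of h_j, which leaves
    [linear_factor_id] with a = h_j, b = h_i. Besides matching coefficients in [c_coef_reorder], it
    gives e_i modulo 1 + (h_j - 1) t. *)
Lemma ehat_recombine j i : i != j ->
  exchange_factor K j i *: map_poly (shift (epsN j)) (ehat K i) +
    (1 / (1 - hh j i)) *: ehat K j = ehat K i.
Proof.
move=> ij; have ji : j != i by rewrite eq_sym.
pose E : {poly Ub} := \prod_(m < n | (m != i) && (m != j)) (1 + h m *: 'X).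
have -> : ehat K i = (1 + h j *: 'X) * E by rewrite /ehat (bigD1 j).
have -> : ehat K j = (1 + h i *: 'X) * E.
  by rewrite /ehat (bigD1 i) //=; congr (_ * _); apply: eq_bigl => m; rewrite andbC.
rewrite rmorphM /= map_poly_linear_factor /= shift_h /epsN eqxx.
have -> : map_poly (shift (epsN j)) E = E.
  rewrite rmorph_prod /=; apply: eq_bigr => m /andP[_ mj].
  by rewrite map_poly_linear_factor /= shift_h /epsN (negPf mj) oppr0 addr0.
rewrite !scalerAl -mulrDl -[(- 1%:Z)%:~R]/(- 1 : Ub).
by rewrite /exchange_factor linear_factor_id // hhB1_unit.
Qed.

(* Its root 1 / (1 - h i) is an interpolation node. *)
Definition shifted_root_factor i : {poly Ub} := 1 + (h i - 1) *: 'X.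

(** Coefficient of t^k in the i-th Lagrange basis polynomial, normalized to agree with e_i at its
    node. It is independent of the polynomial interpolated. *)
Definition interp_coef i (k : nat) : Ub :=
  \prod_(m < n | m != i) ((hh i m - 1) / hh i m) *
    (map_poly (shift (@epsN_all n)) (ehat K i))`_k.

(** Since 1 - h_i is not a unit of Ubar(n), the value at the node is expressed by a congruence
    modulo 1 + (h_i - 1) t; [interpolation] is applied in the fraction field and pulled back by
    injectivity. *)
Lemma interpolation_coef (Q : {poly Ub}) (b : 'I_n -> Ub) (k : nat) :
  (size Q <= n)%N ->
  (forall i, exists S, Q = b i *: ehat K i + shifted_root_factor i * S) ->
  Q`_k = \sum_(i < n) interp_coef i k * b i.
Proof.
move=> sizeQ Qb.
have [F [f f_inj]] : exists (F : fieldType) (f : {rmorphism Ub -> F}), injective f.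
  by exists {fraction {mpoly K[n]}}, \val; exact: val_inj.
pose a i := f (h i).
have a_inj : injective a.
  move=> i j; rewrite /a => /f_inj e; apply/eqP/negP => /negP ij.
  by have := hh_unit K ij; rewrite /Defs.hh e subrr unitr0.
have a1 i : a i != 1.
  rewrite /a -(rmorph1 f) (inj_eq f_inj) -(rmorph1 (@ofpoly K n)) -(inj_eq val_inj).
  rewrite /= tofrac_eq; apply/eqP => /(congr1 (mcoeff U_(i))) /eqP.
  by rewrite mcoeffX eqxx mcoeff1 mnm1_eq0 oner_eq0.
have f_ehat i : map_poly f (ehat K i) = prod_but a i.
  rewrite /ehat rmorph_prod /=; apply: eq_bigr => m _.
  by rewrite map_poly_linear_factor.
have f_shift_ehat i : map_poly f (map_poly (shift (@epsN_all n)) (ehat K i)) =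
    prod_but (fun m => a m - 1) i.
  rewrite map_shift_ehat rmorph_prod /=; apply: eq_bigr => m _.
  by rewrite map_poly_linear_factor rmorphD rmorph_int.
have fQ i : (map_poly f Q).[(1 - a i)^-1] =
    f (b i) * (prod_but a i).[(1 - a i)^-1].
  have [S ->] := Qb i; rewrite rmorphD rmorphM /= map_polyZ /= f_ehat.
  rewrite /shifted_root_factor map_poly_linear_factor /= rmorphB rmorph1.
  rewrite !hornerE -/(a i) [X in _ + X](_ : _ = 0) ?addr0 //.
  rewrite [X in X * _](_ : _ = 0) ?mul0r //.
  by field; rewrite subr_eq0 eq_sym a1.
apply: (f_inj); rewrite -coef_map /=.
have fQsize : (size (map_poly f Q) <= n)%N.
  by rewrite (size_map_inj_poly f_inj (rmorph0 f)).
rewrite (interpolation a_inj a1 fQsize fQ) coef_sum rmorph_sum.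
apply: eq_bigr => i _; rewrite coefZ -f_shift_ehat coef_map /=.
rewrite /interp_coef !rmorphM -!mulrA [f (b i) * _]mulrC.
congr (_ * _); rewrite rmorph_prod; apply: eq_bigr => m mi.
have im : i != m by rewrite eq_sym.
rewrite rmorphM rmorphV ?hh_unit //= rmorphB rmorph1.
by rewrite /Defs.hh rmorphB.
Qed.

(** By [ehat_recombine], e_j is congruent to e_i / (1 - h_ij) modulo 1 + (h_i - 1) t, because
    e_j[-eps_i] contains that factor when j != i. *)
Lemma ehat_coef_interp j (k : nat) :
  (ehat K j)`_k = \sum_(i < n) interp_coef i k * (1 / (1 - hh i j)).
Proof.
apply: interpolation_coef => [|i].
  exact: (size_prod_but h).
have [->|ij] := eqVneq j i.
  exists 0; rewrite mulr0 addr0 /Defs.hh !subrr subr0 divr1 scale1r.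
  by [].
exists (exchange_factor K i j *: \prod_(m < n | (m != i) && (m != j)) (1 + h m *: 'X)).
rewrite -[LHS](ehat_recombine ij) addrC -scalerAr; congr (_ + _ *: _).
rewrite map_shift_ehat (bigD1 i) 1?eq_sym //= /epsN eqxx.
congr (_ * _); rewrite (eq_bigl (fun m => (m != i) && (m != j))); last first.
  by move=> m; rewrite andbC.
apply: eq_bigr => m /andP[mi _].
by rewrite (negPf mi) oppr0 addr0.
Qed.


Lemma map_shift_comp v w (p : {poly Ub}) :
  map_poly (shift v) (map_poly (shift w) p) =
  map_poly (shift (fun i => v i + w i)) p.
Proof.
by apply/polyP => k; rewrite [LHS]coef_map [RHS]coef_map coef_map; exact: shift_comp.
Qed.

(** The difference is a multiple of e_k shifted by v, and the factor 1 + h_i t of e_k becomes 1 +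
    (h_i - 1) t. *)
Lemma shift_step (rho : {poly Ub}) (w : Ub) v i k :
  rho - map_poly (shift (epsN k)) rho = w *: ehat K k -> i != k -> v i = - 1 ->
  exists S, map_poly (shift v) rho - map_poly (shift (fun m => v m + epsN k m)) rho
    = shifted_root_factor i * S.
Proof.
move=> rhok ik vi.
have -> : map_poly (shift v) rho - map_poly (shift (fun m => v m + epsN k m)) rho
    = shift v w *: map_poly (shift v) (ehat K k).
  have L : map_poly (shift v) (rho - map_poly (shift (epsN k)) rho) =
      map_poly (shift v) rho - map_poly (shift v) (map_poly (shift (epsN k)) rho).
    exact: raddfB.
  by rewrite -(map_shift_comp v (epsN k) rho) -L rhok; exact: map_polyZ.
rewrite map_shift_ehat (bigD1 i) //= vi.
exists (shift v w *: \prod_(m < n | (m != k) && (m != i))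
  (1 + (h m + (v m)%:~R) *: 'X)).
by rewrite scalerAr.
Qed.

(** Telescoping: lowering h_i first contributes exactly w_i e_i; the other variables are then
    lowered one at a time, each step being divisible by [shift_step]. *)
Lemma shift_all_root (rho : {poly Ub}) (w : 'I_n -> Ub) i :
  (forall j, rho - map_poly (shift (epsN j)) rho = w j *: ehat K j) ->
  exists S, rho - map_poly (shift (@epsN_all n)) rho =
    w i *: ehat K i + shifted_root_factor i * S.
Proof.
move=> rhoE.
(* The shift [v s] lowers h_i, and then each variable once per occurrence in s. *)
pose v (s : seq 'I_n) m := epsN i m - (count_mem m s)%:Z.
have [S SE] : exists S, map_poly (shift (epsN i)) rho -
    map_poly (shift (v [seq k <- enum 'I_n | k != i])) rho =
    shifted_root_factor i * S.
  elim: (enum 'I_n) => [|k s [S IH]] /=.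
    exists 0; rewrite mulr0 (_ : v [::] = epsN i) ?subrr //.
    by apply/funext => m; rewrite /v subr0.
  case: (eqVneq k i) => [_|ki]; first by exists S.
  have vi : v [seq k <- s | k != i] i = - 1.
    rewrite /v /epsN eqxx (_ : count_mem i _ = 0%N) ?subr0 //.
    by apply/count_memPn; rewrite mem_filter eqxx.
  have ik : i != k by rewrite eq_sym.
  have [T TE] := shift_step (rhoE k) ik vi.
  have -> : v (k :: [seq k <- s | k != i]) =
      (fun m => v [seq k <- s | k != i] m + epsN k m).
    apply/funext => m; rewrite /v /= PoszD opprD /epsN [m == k]eq_sym.
    by rewrite addrA addrAC.
  by exists (S + T); rewrite mulrDr -IH -TE; symmetry; exact: subrKA.
have vE : v [seq k <- enum 'I_n | k != i] = @epsN_all n.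
  apply/funext => m; rewrite /v /epsN /epsN_all.
  rewrite count_uniq_mem; last exact: filter_uniq (enum_uniq 'I_n).
  by rewrite mem_filter mem_enum andbT; case: eqP.
by exists S; rewrite -rhoE -SE -vE; symmetry; exact: subrKA.
Qed.

End UbarPolynomials.

(** * Centrality of c(t) *)

Section Central.
Variables (K : fieldType) (n : nat) (sigma : Ubar K n) (rho : {poly Ubar K n}).
Hypothesis rhoE : forall j : 'I_n,
  rho - map_poly (shift (epsN j)) rho = Delta j sigma *: ehat K j.
Local Notation Ub := (Ubar K n).
Local Notation hh := (@hh K n).
Local Notation C := (dcoef sigma).
Local Notation X := (dx sigma).
Local Notation D := (dd sigma).
Local Notation c := (c_coef sigma rho).
Implicit Types (u : Ub) (i j k : 'I_n).

Lemma dddx_dcoef i u : C u * (D i * X i) = D i * X i * C u.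
Proof. by rewrite mulrA dcoef_dd -!mulrA dx_dcoef. Qed.

(* The shape to which both [x^j c] and [c d_j] reduce. *)
Lemma c_coef_reorder j (k : nat) :
  c k = \sum_(i < n | i != j)
          C (shift (epsN j) (ehat K i)`_k) * (C (exchange_factor K j i) * (D i * X i))
        + C (ehat K j)`_k * (X j * D j) - C (shift (epsN j) rho`_k).
Proof.
(* The term sigma_j e_j that appears here cancels the -sigma_j in x^j d_j. *)
have -> : shift (epsN j) rho`_k = rho`_k - Delta j sigma * (ehat K j)`_k.
  rewrite -coefZ -rhoE coefB coef_map /=.
  by rewrite opprB addrC subrK.
rewrite /c_coef dx_dd_eq; move: (Delta j sigma) => w.
rewrite [C (_ - _)]rmorphB mulrBr opprB [w * _]mulrC [C (_ * w)]rmorphM.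
rewrite !addrA subrK; congr (_ - _).
(* As h_jj = 0, the j-th term in the formula for x^j d_j is y_j itself; the other y_i recombine by
   [ehat_recombine]. *)
rewrite mulr_sumr (bigD1 j) //= [X in _ = _ + X](bigD1 j) //= addrCA -big_split /=.
congr (_ + _); first by rewrite /Defs.hh subrr subr0 divr1 rmorph1 mul1r.
apply: eq_bigr => i ij; rewrite !mulrA -!rmorphM -!mulrDl -rmorphD.
congr (C _ * _ * _); rewrite -[in LHS](ehat_recombine K ij).
by rewrite coefD !coefZ coef_map /= mulrC [in X in _ + X]mulrC.
Qed.

(** Passing x^j shifts the coefficients and multiplies y_i by its exchange factor, while x^j y_j =
    (x^j d_j) x^j and e_j is free of h_j: these are the terms of [c_coef_reorder]. *)
Lemma dx_c_coef j (k : nat) : X j * c k = c k * X j.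
Proof.
rewrite [c k in RHS](c_coef_reorder j) /c_coef mulrBr mulrBl dx_dcoef.
congr (_ - _); rewrite mulr_sumr (bigD1 j) //= addrC mulrDl mulr_suml.
congr (_ + _).
  apply: eq_bigr => i ij; rewrite [LHS]mulrA dx_dcoef -!mulrA; congr (_ * _).
  by rewrite dx_dddx // !mulrA.
by rewrite mulrA dx_dcoef -coef_map /= map_shift_ehat_id -!mulrA.
Qed.

(** As for x^j, now with y_j d_j = d_j (x^j d_j). *)
Lemma c_coef_dd j (k : nat) : c k * D j = D j * c k.
Proof.
rewrite [c k in RHS](c_coef_reorder j) /c_coef mulrBr mulrBl dcoef_dd.
congr (_ - _); rewrite mulr_suml (bigD1 j) //= addrC mulrDr mulr_sumr.
congr (_ + _).
  apply: eq_bigr => i ij; rewrite -mulrA dddx_dd // [LHS]mulrA dcoef_dd.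
  by rewrite -!mulrA.
rewrite -mulrA -(mulrA (D j)) (mulrA (C _) (D j)) dcoef_dd -coef_map /=.
by rewrite map_shift_ehat_id -!mulrA.
Qed.

Lemma c_coef_dcoef u (k : nat) : c k * C u = C u * c k.
Proof.
have CC a b : C a * C b = C b * C a by rewrite -!rmorphM mulrC.
rewrite /c_coef mulrBr mulrBl CC mulr_suml mulr_sumr; congr (_ - _).
by apply: eq_bigr => i _; rewrite -mulrA -dddx_dcoef !mulrA CC.
Qed.

Lemma Diff_central (z : Diff sigma) :
  (forall u, z * C u = C u * z) -> (forall i, z * X i = X i * z) ->
  (forall i, z * D i = D i * z) -> forall a, z * a = a * z.
Proof.
move=> zC zX zD; elim/pclassW; elim=> [u|[i|i]|s IHs|s IHs t IHt|s IHs t IHt].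
- exact: zC.
- exact: zX.
- exact: zD.
- by rewrite pclassN mulrN mulNr IHs.
- by rewrite pclassD mulrDr mulrDl IHs IHt.
- by rewrite pclassM mulrA IHs -mulrA IHt mulrA.
Qed.

End Central.

(** * The vacuum vector and the action of central elements *)

Section LowestWeight.
Variables (K : fieldType) (n : nat) (sigma : Ubar K n).
Local Notation Ub := (Ubar K n).
Local Notation C := (dcoef sigma).
Variables (lam : 'I_n -> K) (M : lmodType (Dn sigma)) (vac : M).
Hypothesis lamP : forall i j : 'I_n, i != j -> forall a : int, lam i - lam j != a%:~R.
Hypothesis vacP : is_lowest_weight_module lam vac.
Local Notation w := (ipure (subring_incl (@Dn_gen K n sigma)) 1 vac : Ind M).

Lemma scale_ipure a b (m : M) :
  a *: (ipure (subring_incl (@Dn_gen K n sigma)) b m : Ind M) =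
  ipure (subring_incl (@Dn_gen K n sigma)) (a * b) m.
Proof. exact: iscaleE. Qed.

Lemma ipure_balanced a (s : Dn sigma) (m : M) :
  ipure (subring_incl (@Dn_gen K n sigma)) (a * \val s) m =
  ipure (subring_incl (@Dn_gen K n sigma)) a (s *: m).
Proof. exact/tclassP/tc_balanced. Qed.

Lemma scale_vacuum (s : Dn sigma) :
  \val s *: w = ipure (subring_incl (@Dn_gen K n sigma)) 1 (s *: vac).
Proof. by rewrite scale_ipure mulr1 -ipure_balanced mul1r. Qed.

Lemma dd_vacuum i : dd sigma i *: w = 0.
Proof.
have [_ _ ddv] := vacP.
rewrite -[dd sigma i]/(\val (nd sigma i)) scale_vacuum ddv.
(* The tensor of 1 with 0 vanishes by cancellation, splitting 0 as 0 + 0. *)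
apply: (addIr (ipure (subring_incl (@Dn_gen K n sigma)) 1 (0 : M) : Ind M)).
rewrite add0r -tclassD -[in RHS](addr0 (0 : M)).
by symmetry; apply/tclassP/tc_pureDr.
Qed.

Lemma dscal_central (a : K) (z : Diff sigma) : z * dscal sigma a = dscal sigma a * z.
Proof.
symmetry; move: z; apply: Diff_central => [u|i|i].
- by rewrite -!rmorphM mulrC.
- by have := pclass_rel (dr_Kx sigma a i); rewrite !pclassM.
- by have := pclass_rel (dr_Kd sigma a i); rewrite !pclassM.
Qed.

Lemma dscalD (a b : K) : dscal sigma (a + b) = dscal sigma a + dscal sigma b.
Proof. by rewrite /dscal /uconst mpolyCD !rmorphD. Qed.

Lemma dscalM (a b : K) : dscal sigma (a * b) = dscal sigma a * dscal sigma b.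
Proof. by rewrite /dscal /uconst mpolyCM !rmorphM. Qed.

Lemma dscal1 : dscal sigma 1 = 1.
Proof. by rewrite /dscal /uconst mpolyC1 !rmorph1. Qed.

(** The module is over Diff only, so eigenvalues enter through [dscal], and a passes the eigenvalue
    y because [dscal] is central. *)
Lemma eigenM (a b : Diff sigma) (x y : K) :
  a *: w = dscal sigma x *: w -> b *: w = dscal sigma y *: w ->
  (a * b) *: w = dscal sigma (x * y) *: w.
Proof.
move=> aw bw; rewrite -scalerA bw scalerA dscal_central -scalerA aw scalerA.
by rewrite -dscalM mulrC.
Qed.

Lemma ofpoly_vacuum (p : {mpoly K[n]}) :
  C (ofpoly p) *: w = dscal sigma p.@[lam] *: w.
Proof.
have [_ hv _] := vacP.
elim/mpolyind: p => [|a m p _ _ IH].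
  by rewrite meval0 /dscal /uconst mpolyC0.
rewrite rmorphD [C _]rmorphD scalerDl IH mevalD dscalD scalerDl; congr (_ + _).
rewrite -mul_mpolyC rmorphM [C _]rmorphM mevalM; apply: eigenM.
  by rewrite mevalC.
rewrite mpolyXE_id !rmorph_prod /=; elim/big_ind2: _ => //.
- by rewrite dscal1.
- by move=> x a' y b'; exact: (eigenM).
move=> i _; rewrite !rmorphXn /= mevalXU.
elim: (m i) => [|e IHe]; first by rewrite !expr0 dscal1.
rewrite !exprS; apply: eigenM => //.
rewrite -[C (ofpoly _)]/(\val (ncoef sigma (h K i))) scale_vacuum hv.
by rewrite -scale_vacuum.
Qed.

Lemma dcoef_vacuum u : C u *: w = dscal sigma (ueval lam u) *: w.
Proof.
rewrite [u in LHS]unum_uden /ueval; set p := unum u; set s := uden u.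
have sP : denom s by exact: uden_denom.
have s0 : s.@[lam] != 0 by exact: denom_eval.
rewrite [C _]rmorphM; apply: eigenM; first exact: ofpoly_vacuum.
(* By genericity of lam, s(lam) is nonzero; w is thus a multiple of s w, to which 1/s applies. *)
have e : w = dscal sigma (s.@[lam])^-1 *: (C (ofpoly s) *: w).
  by rewrite ofpoly_vacuum scalerA -dscalM mulVf // dscal1 scale1r.
rewrite [w in LHS]e [LHS]scalerA dscal_central -scalerA [X in _ *: X]scalerA -rmorphM.
by rewrite mulVr ?ofpoly_unit // rmorph1 scale1r.
Qed.

(** Since vac spans M, every pure tensor is a multiple b w with b in Diff, and z moves past b. *)
Lemma lowest_weight_scalar (z : Diff sigma) (a : K) :
  (forall b, z * b = b * z) -> z *: w = dscal sigma a *: w ->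
  forall v : Ind M, z *: v = dscal sigma a *: v.
Proof.
have [vac1 _ _] := vacP.
move=> zC zw; elim/tclassW; elim=> [b m||t IH|t IHt u IHu].
- have [x [-> _]] := vac1 m.
  rewrite -[tclass _ _]/(ipure (subring_incl (@Dn_gen K n sigma)) b
    (nscal sigma x *: vac)).
  rewrite -ipure_balanced -[X in ipure _ X _]mulr1 -scale_ipure.
  by rewrite [LHS]scalerA zC -scalerA zw !scalerA dscal_central.
- by rewrite tclass0 !scaler0.
- by rewrite tclassN !scalerN IH.
- by rewrite tclassD !scalerDr IHt IHu.
Qed.

End LowestWeight.

(** * The value of c(t) on the vacuum, and the theorem *)

Lemma c_coef_vacuum (K : fieldType) (n : nat) (sigma : Ubar K n)
    (rho : {poly Ubar K n}) (size_rho : (size rho <= n)%N)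
    (rhoE : forall j : 'I_n,
        rho - map_poly (shift (epsN j)) rho = (Delta j sigma) *: ehat K j)
    (V : lmodType (Diff sigma)) (w : V) (dw : forall i, dd sigma i *: w = 0) k :
  c_coef sigma rho k *: w =
  dcoef sigma (- map_poly (shift (@epsN_all n)) rho)`_k *: w.
Proof.
pose Q := rho - map_poly (shift (@epsN_all n)) rho.
have sizeQ : (size Q <= n)%N.
  rewrite (leq_trans (size_polyD _ _)) // size_polyN geq_max size_rho.
  exact: leq_trans (size_poly _ _) size_rho.
have QE : Q`_k = \sum_(i < n) interp_coef K i k * Delta i sigma.
  by apply: interpolation_coef => // i; apply: shift_all_root rhoE.
(* This is x^i d_i w = 0 after expanding x^i d_i. *)
have xdw i :
    \sum_(j < n) (dcoef sigma (1 / (1 - hh K i j)) * (dd sigma j * dx sigma j)) *: w =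
    dcoef sigma (Delta i sigma) *: w.
  apply/eqP; rewrite -subr_eq0 -scaler_suml -scalerBl -dx_dd_eq -scalerA dw.
  by rewrite scaler0.
have -> : (- map_poly (shift (@epsN_all n)) rho)`_k = Q`_k - rho`_k.
  by rewrite /Q coefB coefN addrC addrA addNr add0r.
rewrite QE /c_coef rmorphB !scalerBl; congr (_ - _).
rewrite rmorph_sum !scaler_suml.
(* Each sigma_i w is replaced by its expansion in the y_j w; summing over i first, the coefficient
   of y_j w becomes that of e_j. *)
under [RHS]eq_bigr => i _ do rewrite rmorphM -scalerA -xdw scaler_sumr.
rewrite exchange_big /=; apply: eq_bigr => j _.
rewrite ehat_coef_interp rmorph_sum mulr_suml scaler_suml.
by apply: eq_bigr => i _; rewrite rmorphM scalerA !mulrA.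
Qed.

Theorem proposition3p10 (R : realType) (n : nat) (hn : (1 <= n)%N)
    (sigma : Ubar R[i] n) (hsigma : in_W sigma)
    (rho : {poly Ubar R[i] n}) (hdeg : (size rho <= n)%N)
    (hrho : forall j : 'I_n,
        rho - map_poly (shift (epsN j)) rho = (Delta j sigma) *: ehat R[i] j)
    (lam : 'I_n -> R[i])
    (hlam : forall i j : 'I_n, i != j ->
        forall a : int, lam i - lam j != a%:~R)
    (M : lmodType (Dn sigma)) (vac : M)
    (hM : is_lowest_weight_module lam vac)
    (k : nat) (v : Ind M) :
  c_coef sigma rho k *: v =
  dscal sigma (ueval lam (- map_poly (shift (@epsN_all n)) rho)`_k) *: v.
Proof.
apply: (lowest_weight_scalar hM) => [b|].
  apply: Diff_central => [u|j|j]; first exact: c_coef_dcoef.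
  - by rewrite dx_c_coef.
  - exact: c_coef_dd.
rewrite -(dcoef_vacuum hlam hM); apply: c_coef_vacuum => // i.
exact: dd_vacuum hM i.
Qed.
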